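(* Let $G_1$ and $G_2$ be graphs on $n$ vertices each, with disjoint vertex sets, and let $f: V(G_1)\to V(G_2)$ be a bijection. Let $G_1 \boxminus_f G_2$ be the graph with vertex set $V(G_1)\cup V(G_2)$ in which $V(G_i)$ induces $G_i$ for $i=1,2$ and the edges between $V(G_1)$ and $V(G_2)$ are exactly $\{v f(v) : v\in V(G_1)\}$. Then $\mathrm{thin}\big(\overline{G_1 \boxminus_f G_2}\big) \geq n/2$.
   Context: All graphs are finite, simple and undirected; $\overline{H}$ denotes the complement of $H$. For a graph $G=(V,E)$, an ordering $v_1,\dots,v_n$ of $V$ and a partition of $V$ into classes are consistent if for every triple $r<s<t$, whenever $v_r,v_s$ are in the same class and $v_tv_r\in E$, then $v_tv_s\in E$. The thinness $\mathrm{thin}(G)$ is the minimum $k$ such that there are an ordering of $V$ and a partition of $V$ into $k$ classes that are consistent. *)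

(* Defs.v *)
From mathcomp Require Import all_boot all_order all_algebra.

Set Implicit Arguments.
Unset Strict Implicit.
Unset Printing Implicit Defensive.

Record sgraph := SGraph {
  vertex :> finType;
  adj : rel vertex;
  adj_sym : symmetric adj;
  adj_irr : irreflexive adj
}.

Definition compl_adj (G : sgraph) : rel G :=
  fun x y => (x != y) && ~~ adj x y.

Lemma compl_adj_sym (G : sgraph) : symmetric (@compl_adj G).
Proof. by move=> x y; rewrite /compl_adj eq_sym adj_sym. Qed.

Lemma compl_adj_irr (G : sgraph) : irreflexive (@compl_adj G).
Proof. by move=> x; rewrite /compl_adj eqxx. Qed.

Definition compl_graph (G : sgraph) : sgraph :=
  SGraph (@compl_adj_sym G) (@compl_adj_irr G).

(* The vertex set is the sum type, so the two vertex sets are disjoint. *)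
Definition matching_adj (G1 G2 : sgraph) (f : G1 -> G2) : rel (G1 + G2)%type :=
  fun x y => match x, y with
  | inl u, inl v => adj u v
  | inr u, inr v => adj u v
  | inl u, inr v => v == f u
  | inr v, inl u => v == f u
  end.

Lemma matching_adj_sym (G1 G2 : sgraph) (f : G1 -> G2) :
  symmetric (matching_adj f).
Proof. by move=> [x|x] [y|y] //=; rewrite adj_sym. Qed.

Lemma matching_adj_irr (G1 G2 : sgraph) (f : G1 -> G2) :
  irreflexive (matching_adj f).
Proof. by move=> [x|x] /=; rewrite adj_irr. Qed.

Definition matching_graph (G1 G2 : sgraph) (f : G1 -> G2) : sgraph :=
  SGraph (matching_adj_sym f) (matching_adj_irr f).

Section Thinness.
Variable G : sgraph.

(* An ordering v_1, ..., v_n of the vertices is an injective map v from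
   'I_#|G| to G; a partition into classes is a P with partition P [set: G],
   and pblock P x is then the class of x. *)
Definition consistent (v : {ffun 'I_#|G| -> G}) (P : {set {set G}}) : bool :=
  [forall r : 'I_#|G|, forall s : 'I_#|G|, forall t : 'I_#|G|,
    [&& r < s, s < t, pblock P (v r) == pblock P (v s) & adj (v t) (v r)]
      ==> adj (v t) (v s)].

Lemma consistentP (v : {ffun 'I_#|G| -> G}) (P : {set {set G}}) :
  reflect
    (forall r s t : 'I_#|G|, r < s -> s < t ->
       pblock P (v r) = pblock P (v s) -> adj (v t) (v r) -> adj (v t) (v s))
    (consistent v P).
Proof.
apply: (iffP idP) => [/forallP h r s t rs st e a | h].
  have /forallP/(_ s)/forallP/(_ t)/implyP := h r.
  by apply; rewrite rs st e eqxx a.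
apply/forallP => r; apply/forallP => s; apply/forallP => t; apply/implyP.
by case/and4P => rs st /eqP e a; exact: h e a.
Qed.

Definition has_consistent (k : nat) : bool :=
  [exists v : {ffun 'I_#|G| -> G}, exists P : {set {set G}},
    [&& injectiveb v, partition P [set: G], #|P| == k & consistent v P]].

Lemma thin_exists : exists k, has_consistent k.
Proof.
pose P := preim_partition (@id G) [set: G].
have parP : partition P [set: G] by exact: preim_partitionP.
exists #|P|; apply/existsP; exists [ffun i => enum_val i].
apply/existsP; exists P; apply/and4P; split=> //.
  by apply/injectiveP => i j; rewrite !ffunE; exact: enum_val_inj.
apply/consistentP => r s t _ _; rewrite !ffunE => e.
have covP x : x \in cover P by rewrite (cover_partition parP) inE.
have: enum_val s \in pblock P (enum_val r) by rewrite e mem_pblock.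
by rewrite pblock_equivalence_partition ?inE // => [/eqP-> | x y z];
  last by split=> // /eqP->.
Qed.

Definition thin : nat := ex_minn thin_exists.

End Thinness.

(* Main.v *)
(** For each matched pair [u, f u], consider the endpoint that comes first in a
    consistent ordering.  If two such first endpoints [a < a'] lay in the same
    [V(G_i)] and in the same class, the partner [b'] of [a'] would come after
    both of them and, in the complement, be adjacent to [a] but not to [a'],
    against consistency.  So every class contains at most one first endpoint
    from each of [V(G_1)] and [V(G_2)], and there are [n] first endpoints. *)

Require Import Defs.
From mathcomp Require Import all_boot all_order all_algebra.

Set Implicit Arguments.
Unset Strict Implicit.
Unset Printing Implicit Defensive.

Section FirstEndpoints.

Variables (G1 G2 : sgraph) (f : G1 -> G2).
Let H := compl_graph (matching_graph f).
Variables (v : {ffun 'I_#|H| -> H}) (g : H -> 'I_#|H|) (P : {set {set H}}).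
Hypotheses (f_inj : injective f) (gK : cancel g v) (consP : consistent v P).

(** Since [g] inverts the ordering [v], [g x] is the position of [x], and consistency can be used on
    vertices instead of indices. *)
Lemma consistent_rank (x y z : H) :
  g x < g y -> g y < g z -> pblock P x = pblock P y -> adj z x -> adj z y.
Proof.
move=> xy yz e; have /consistentP/(_ _ _ _ xy yz) := consP.
by rewrite !gK; apply.
Qed.

Definition left_first (u : G1) : bool :=
  g (inl u : H) < g (inr (f u) : H).

Definition first_endpoint (u : G1) : H :=
  if left_first u then inl u else inr (f u).

Lemma left_firstN (u : G1) :
  ~~ left_first u -> g (inr (f u) : H) < g (inl u : H).
Proof.
rewrite /left_first -leqNgt leq_eqVlt => /orP[|//].
by move=> /eqP/val_inj/(can_inj gK).
Qed.

Lemma first_endpoint_ltF (u w : G1) :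
  left_first u = left_first w ->
  pblock P (first_endpoint u) = pblock P (first_endpoint w) ->
  g (first_endpoint u) < g (first_endpoint w) -> False.
Proof.
move=> s e lt_uw; have u_neq_w : u != w.
  by apply: contraTneq lt_uw => ->; rewrite ltnn.
move: e lt_uw; rewrite /first_endpoint s.
case: ifPn => [lt_w | /left_firstN lt_w] e lt_uw.
(* The third vertex is the partner of the later endpoint: [inr (f w)] here, [inl w] in the other
   case. *)
- have := consistent_rank lt_uw lt_w e.
  rewrite /= /compl_adj /= eqxx /= (inj_eq f_inj) eq_sym u_neq_w.
  by move=> /(_ isT).
- have := consistent_rank lt_uw lt_w e.
  rewrite /= /compl_adj /= eqxx /= (inj_eq f_inj) u_neq_w.
  by move=> /(_ isT).
Qed.

Lemma first_endpoint_inj : injective first_endpoint.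
Proof.
by rewrite /first_endpoint => u w; do 2 case: ifP => _; case=> // /f_inj.
Qed.

(** The boolean records the side, so equal pairs would put two first endpoints of one side in one
    class. *)
Lemma first_endpoint_class_inj :
  injective (fun u => (pblock P (first_endpoint u), left_first u)).
Proof.
move=> u w [e s].
case: (ltngtP (g (first_endpoint u)) (g (first_endpoint w))) => [uw|wu|].
- by case: (first_endpoint_ltF s e uw).
- by case: (first_endpoint_ltF (esym s) (esym e) wu).
- by move=> /val_inj/(can_inj gK)/first_endpoint_inj.
Qed.

Lemma card_le_double_classes : partition P [set: H] -> #|G1| <= #|P| * 2.
Proof.
move=> parP; rewrite -(card_imset predT first_endpoint_class_inj).
(* The factor 2 counts the sides: the pairs lie in the product of [P] and [bool]. *)
rewrite -card_bool -(cardsT bool) -cardsX; apply: subset_leq_card.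
apply/subsetP => _ /imsetP[u _ ->].
by rewrite !inE andbT pblock_mem // (cover_partition parP) inE.
Qed.

End FirstEndpoints.

Lemma leq_card_double_thin (G1 G2 : sgraph) (f : G1 -> G2) :
  injective f -> #|G1| <= thin (compl_graph (matching_graph f)) * 2.
Proof.
move=> f_inj; rewrite /thin; case: ex_minnP => k /existsP[v /existsP[P]] + _.
case/and4P=> /injectiveP v_inj parP /eqP <- consP.
(* There are as many indices as vertices, so the injective [v] has an inverse. *)
have [g _ gK] : bijective v by apply: inj_card_bij; rewrite ?card_ord.
exact: card_le_double_classes gK consP parP.
Qed.

Theorem theorem3p3 (n : nat) (G1 G2 : sgraph) (hG1 : #|G1| = n) (hG2 : #|G2| = n)
    (f : G1 -> G2) (hf : bijective f) :
  ((thin (compl_graph (matching_graph f)))%:R >= n%:R / 2%:R :> rat)%R.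
Proof.
rewrite Num.Theory.ler_pdivrMr ?Num.Theory.ltr0n //.
rewrite -GRing.natrM Num.Theory.ler_nat -hG1.
exact: leq_card_double_thin (bij_inj hf).
Qed.
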